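(* Let $n\ge2$, let $R$ be a commutative ring with unit such that the natural ring homomorphism $\mathbb Z\to R$ is injective, and let $\theta$ be an $R$-valued Magnus expansion of the free group $F_n$. For each $m\ge1$, the restriction of the $m$-th Johnson map $\tau^\theta_m$ to the subgroup $A(m)\subset\mathrm{Aut}(F_n)$ coincides with the $m$-th Johnson homomorphism: $$\tau_m=\tau^\theta_m|_{A(m)}:A(m)\to H^*\otimes H^{\otimes(m+1)}.$$ In particular, the restriction $\tau^\theta_m|_{A(m)}$ is a group homomorphism independent of the choice of the Magnus expansion $\theta$.
   Context: $R$ is a commutative ring with unit, $F_n$ a free group of rank $n\ge2$, $H_{\mathbb Z}=F_n^{\mathrm{abel}}$, $H=H_1(F_n;R)=H_{\mathbb Z}\otimes_{\mathbb Z}R$, $H^*=\mathrm{Hom}_R(H,R)$; $[\gamma]\in H$ is the class of $\gamma\in F_n$. $\widehat T=\prod_{m\ge0}H^{\otimes m}$, $\widehat T_p=\prod_{m\ge p}H^{\otimes m}$ (tensor products over $R$). A Magnus expansion is a group homomorphism $\theta:F_n\to1+\widehat T_1$ with $\theta(\gamma)\equiv1+[\gamma]\pmod{\widehat T_2}$; write $\theta_m(\gamma)\in H^{\otimes m}$ for its components. Johnson maps: $IA(\widehat T)$ is the group of $R$-algebra automorphisms $U$ of $\widehat T$ with $U(\widehat T_p)=\widehat T_p$ for all $p\geq 1$ inducing the identity on $\widehat T_1/\widehat T_2=H$; it acts freely and transitively on Magnus expansions by $U\cdot\theta=U\circ\theta$. For $\varphi\in\mathrm{Aut}(F_n)$,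 let $|\varphi|\in GL(H)$ be the induced map, acting on $H^{\otimes m}$ by $|\varphi|^{\otimes m}$. $\tau^\theta(\varphi)\in IA(\widehat T)$ is the unique element with $\theta\circ\varphi=\tau^\theta(\varphi)\circ|\varphi|\circ\theta$, and $\tau^\theta_p(\varphi)\in\mathrm{Hom}(H,H^{\otimes(p+1)})=H^*\otimes H^{\otimes(p+1)}$ is defined by $\tau^\theta(\varphi)|_H=1_H+\sum_{p\ge1}\tau^\theta_p(\varphi)$. Johnson homomorphisms: $\Gamma_1=F_n$, $\Gamma_{m+1}=[\Gamma_m,F_n]$ is the lower central series, and $A(m)=\mathrm{Ker}(\mathrm{Aut}(F_n)\to\mathrm{Aut}(\Gamma_1/\Gamma_{m+1}))$. When $\mathbb Z\to R$ is injective, one has $\theta^{-1}(1+\widehat T_m)=\Gamma_m$, and $\theta_m$ induces an injective homomorphism $\Gamma_m/\Gamma_{m+1}\hookrightarrow H^{\otimes m}$, which does not depend on $\theta$; its image is denoted $\mathcal L_m$ and identified with $\Gamma_m/\Gamma_{m+1}$. For $\varphi\in A(m)$, the map $\gamma\mapsto\gamma^{-1}\varphi(\gamma)\bmod\Gamma_{m+2}\in\Gamma_{m+1}/\Gamma_{m+2}=\mathcal L_{m+1}$ is a group homomorphism on $F_n$, hence defines $\tau_m(\varphi)\in\mathrm{Hom}_{\mathbb Z}(H_{\mathbb Z},\mathcal L_{m+1})$; $\tau_m:A(m)\to\mathrm{Hom}_{\mathbb Z}(H_{\mathbb Z},\mathcal L_{m+1})$ is the $m$-th Johnson homomorphism.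 By $R$-linear extension, $\mathrm{Hom}_{\mathbb Z}(H_{\mathbb Z},\mathcal L_{m+1})$ is regarded as a $\mathbb Z$-submodule of $\mathrm{Hom}(H,H^{\otimes(m+1)})=H^*\otimes H^{\otimes(m+1)}$. *)

(* Defs.v *)
From HB Require Import structures.
From mathcomp Require Import all_boot all_order all_algebra.
From mathcomp Require Import mathcomp_extra boolp classical_sets functions.

Set Implicit Arguments.
Unset Strict Implicit.
Unset Printing Implicit Defensive.

Import GRing.Theory.

Local Open Scope classical_set_scope.
Local Open Scope ring_scope.

Section Groups.
Variable F : groupType.

Definition is_subgroup (K : set F) : Prop :=
  K 1%g /\ forall a b : F, K a -> K b -> K (a * b^-1)%g.

(* lcs m is Gamma_m, with Gamma_1 = F; the value at m = 0 is irrelevant. *)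
Fixpoint lcs (m : nat) : set F :=
  if m is k.+1 then
    if k is 0%N then setT
    else smallest is_subgroup [set c | exists2 a, lcs k a & exists b, c = [~ a, b]%g]
  else setT.

Definition coset (K : set F) (a : F) : set F := [set (a * d)%g | d in K].

Definition is_aut (phi : F -> F) : Prop :=
  {morph phi : a b / (a * b)%g} /\ bijective phi.

(* A(m) is the kernel of Aut(F) -> Aut(F / Gamma_{m+1}). *)
Definition andreadakis (m : nat) : set (F -> F) :=
  [set phi | is_aut phi /\
     forall a, coset (lcs m.+1) (phi a) = coset (lcs m.+1) a].

End Groups.

Definition free_basis (F : groupType) (n : nat) (x : 'I_n -> F) : Prop :=
  forall (K : groupType) (f : 'I_n -> K),
    exists! g : F -> K, {morph g : a b / (a * b)%g} /\ forall i, g (x i) = f i.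

(* For F free on x_1, ..., x_n, the module H = F^ab (x) R is free on the classes
   [x_i], and is identified with R^n accordingly.  Then H^{(x) m} is free on the
   words of length m in the letters x_1, ..., x_n. *)
Notation Hmod R n := 'rV[R]_n.

Notation Hpow R n m := {ffun m.-tuple 'I_n -> R^o}.

(* An element of prod_m H^{(x) m} is its family of coordinates over all words;
   the tensor product of two basis words is their concatenation. *)
Definition That (R : comNzRingType) (n : nat) : Type := seq 'I_n -> R^o.
HB.instance Definition _ R n := GRing.Lmodule.copy (That R n) (seq 'I_n -> R^o).

Section CompletedTensorAlgebra.
Variables (R : comNzRingType) (n : nat).
Local Notation T := (That R n).

Definition That_one : T := fun w => (w == [::])%:R.
Definition That_mul (s t : T) : T :=
  fun w => \sum_(k < (size w).+1) s (take k w) * t (drop k w).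

Fact That_mul_nil s t : That_mul s t [::] = s [::] * t [::].
Proof. by rewrite /That_mul big_ord_recl big_ord0 addr0. Qed.

Fact That_mul_cons s t i w : That_mul s t (i :: w) =
  s [::] * t (i :: w) + That_mul (s \o cons i) t w.
Proof. by rewrite /That_mul big_ord_recl. Qed.

Fact That_mulDl : left_distributive That_mul +%R.
Proof.
move=> r s t; apply/funext => w.
change (That_mul (r + s) t w = That_mul r t w + That_mul s t w).
by rewrite /That_mul -big_split; apply: eq_bigr => k _; exact: mulrDl.
Qed.

Fact That_mulDr : right_distributive That_mul +%R.
Proof.
move=> r s t; apply/funext => w.
change (That_mul r (s + t) w = That_mul r s w + That_mul r t w).
by rewrite /That_mul -big_split; apply: eq_bigr => k _; exact: mulrDr.
Qed.

Fact That_mulZl (c : R) (s t : T) : c *: That_mul s t = That_mul (c *: s) t.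
Proof.
apply/funext => w; change (c * That_mul s t w = That_mul (c *: s) t w).
by rewrite /That_mul mulr_sumr; apply: eq_bigr => k _; exact: mulrA.
Qed.

Fact That_mulZr (c : R) (s t : T) : c *: That_mul s t = That_mul s (c *: t).
Proof.
apply/funext => w; change (c * That_mul s t w = That_mul s (c *: t) w).
by rewrite /That_mul mulr_sumr; apply: eq_bigr => k _; exact: mulrCA.
Qed.

Fact That_mulA : associative That_mul.
Proof.
move=> r s t; apply/funext => w; elim: w r => [|i w IHw] r.
  by rewrite !That_mul_nil mulrA.
rewrite That_mul_cons [RHS]That_mul_cons That_mul_nil.
have -> : That_mul r s \o cons i =
    r [::] *: ((s \o cons i) : T) + That_mul (r \o cons i) s.
  by apply/funext => v; exact: That_mul_cons.
rewrite That_mulDl -That_mulZl.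
change (r [::] * That_mul s t (i :: w) + That_mul (r \o cons i) (That_mul s t) w =
  r [::] * s [::] * t (i :: w) + (r [::] * That_mul (s \o cons i) t w +
  That_mul (That_mul (r \o cons i) s) t w)).
by rewrite IHw That_mul_cons mulrDr -!addrA mulrA.
Qed.

Fact That_mul1l : left_id That_one That_mul.
Proof.
move=> s; apply/funext => w.
rewrite /That_mul big_ord_recl take0 drop0 /That_one eqxx mul1r big1 ?addr0// => k _.
by case: w k => [[]//|i w] k; rewrite /= mul0r.
Qed.

Fact That_mul1r : right_id That_one That_mul.
Proof.
move=> s; apply/funext => w; rewrite /That_mul big_ord_recr /= take_size drop_size.
rewrite /That_one eqxx mulr1 big1 ?add0r// => k _.
by rewrite -size_eq0 size_drop subn_eq0 leqNgt ltn_ord mulr0.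
Qed.

Fact That_oner_neq0 : That_one != 0.
Proof.
apply/eqP => /(congr1 (fun s : T => s [::])); apply/eqP.
by rewrite /That_one eqxx; exact: oner_neq0.
Qed.

HB.instance Definition _ := GRing.Zmodule_isNzRing.Build T
  That_mulA That_mul1l That_mul1r That_mulDl That_mulDr That_oner_neq0.
HB.instance Definition _ :=
  GRing.LSemiModule_isLSemiAlgebra.Build R T That_mulZl.
HB.instance Definition _ :=
  GRing.LSemiAlgebra_isSemiAlgebra.Build R T That_mulZr.

(* That_ge p is the ideal prod_{m >= p} H^{(x) m}. *)
Definition That_ge (p : nat) : set T :=
  [set t | forall w, (size w < p)%N -> t w = 0].

Definition component (m : nat) (t : T) : Hpow R n m := [ffun w => t (val w)].

Definition of_H (v : Hmod R n) : T :=
  fun w => if w is [:: i] then v 0 i else 0.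

Definition pure_tensor (m : nat) (v : 'I_m -> Hmod R n) : Hpow R n m :=
  [ffun w => \prod_(k < m) v k 0 (tnth w k)].

Definition Hpow_map (m : nat) (A : 'End(Hmod R n)) (t : Hpow R n m) : Hpow R n m :=
  \sum_(w : m.-tuple 'I_n)
    t w *: pure_tensor (fun k => A (delta_mx 0 (tnth w k))).

(* The action of A on T, by A^{(x) m} in each degree m. *)
Definition That_map (A : 'End(Hmod R n)) (t : T) : T :=
  fun w => Hpow_map A (component (size w) t) (in_tuple w).

Definition IA_That (U : T -> T) : Prop :=
  [/\ linear U, monoid_morphism U, bijective U,
      forall p, (1 <= p)%N -> U @` That_ge p = That_ge p
    & forall t, That_ge 1 t -> That_ge 2 (U t - t)].

End CompletedTensorAlgebra.

(* The additive group of V, written multiplicatively. *)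
Definition addgroup (V : zmodType) : Type := V.
HB.instance Definition _ (V : zmodType) := Choice.on (addgroup V).
HB.instance Definition _ (V : zmodType) := isGroup.Build (addgroup V)
  (@addrA V) (@add0r V) (@addr0 V) (@addNr V) (@addrN V).

Section Johnson.
Variables (R : comNzRingType) (n : nat) (F : groupType) (x : 'I_n -> F).
Local Notation T := (That R n).
Local Notation H := (Hmod R n).

(* The class [gamma] in H. *)
Definition hclass : F -> H :=
  xget (fun=> 0) [set f | {morph f : a b / (a * b)%g >-> a + b} /\
                          forall i, f (x i) = delta_mx 0 i].

Fact hclassP (hx : free_basis x) :
  {morph hclass : a b / (a * b)%g >-> a + b} /\
  forall i, hclass (x i) = delta_mx 0 i.
Proof.
have [g [gP _]] := hx (addgroup 'rV[R]_n) (delta_mx 0).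
pose P := [set f : F -> 'rV[R]_n | {morph f : a b / (a * b)%g >-> a + b} /\
  forall i, f (x i) = delta_mx 0 i].
exact: (@xgetI _ (fun=> 0) P g gP).
Qed.

(* R-linear extension to H = F^ab (x) R of a homomorphism f from F to (the
   additive group of) M. *)
Definition lin_ext (M : vectType R) (f : F -> M) : 'Hom(H, M) :=
  xget 0 [set g : 'Hom(H, M) | forall a, g (hclass a) = f a].

(* Universal property: hclass presents H as F^ab (x) R. *)
Fact lin_extP (hx : free_basis x) (M : vectType R) (f : F -> M) :
  {morph f : a b / (a * b)%g >-> a + b} ->
  (forall a, lin_ext f (hclass a) = f a) /\
  forall g : 'Hom('rV[R]_n, M),
    (forall a, g (hclass a) = f a) -> g = lin_ext f.
Proof.
have [hM hx1] := hclassP hx => fM.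
pose g0 (v : 'rV[R]_n) := \sum_i v 0 i *: f (x i).
have g0L : linear g0.
  move=> c u v; rewrite /g0 scaler_sumr -big_split; apply: eq_bigr => i _.
  by rewrite !mxE scalerDl scalerA.
pose G0 := HB.pack_for {linear 'rV[R]_n -> M} g0
  (GRing.isLinear.Build _ _ _ _ _ g0L).
have g0x i : g0 (delta_mx 0 i) = f (x i).
  rewrite /g0 (bigD1 i)//= big1 ?addr0 ?mxE ?eqxx ?scale1r// => j ji.
  by rewrite mxE (negbTE ji) andbF scale0r.
have g0P a : linfun G0 (hclass a) = f a.
  have [h [_ hU]] := hx (addgroup M) (f \o x).
  have <- : h = f by apply: hU; split.
  move: a; apply/funeqP/esym/hU; split => [a b|i] /=.
    by rewrite hM linearD.
  by rewrite hx1 (lfunE G0); exact: g0x.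
have uniq (g g' : 'Hom('rV[R]_n, M)) : (forall a, g (hclass a) = f a) ->
    (forall a, g' (hclass a) = f a) -> g = g'.
  move=> gP g'P; apply/lfunP => v; rewrite (row_sum_delta v) !linear_sum.
  by apply: eq_bigr => i _; rewrite !linearZ /= -hx1 gP g'P.
have P : forall a, lin_ext f (hclass a) = f a.
  pose S := [set g : 'Hom(H, M) | forall a, g (hclass a) = f a].
  exact: (@xgetI _ 0 S _ g0P).
by split=> // g gP; apply: uniq.
Qed.

Definition aut_H (phi : F -> F) : 'End(H) := lin_ext (hclass \o phi).

Definition magnus_expansion (theta : F -> T) : Prop :=
  [/\ forall a, That_ge 1 (theta a - 1),
      {morph theta : a b / (a * b)%g >-> a * b}
    & forall a, That_ge 2 (theta a - (1 + of_H (hclass a)))].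

(* tau^theta(phi), the unique U in IA(T) with theta \o phi = U \o |phi| \o theta. *)
Definition johnson_total (theta : F -> T) (phi : F -> F) : T -> T :=
  xget (idfun : T -> T) [set U : T -> T | IA_That U /\
                   theta \o phi = U \o That_map (aut_H phi) \o theta].

Definition johnson_map (theta : F -> T) (p : nat) (phi : F -> F) :
    'Hom(H, Hpow R n p.+1) :=
  linfun (fun v => component p.+1 (johnson_total theta phi (of_H v))).

(* The embedding Gamma_m / Gamma_{m+1} -> H^{(x) m}: it sends a coset C to the
   common value on C of the degree m components of all the Magnus expansions. *)
Definition gr_embed (m : nat) (C : set F) : Hpow R n m :=
  xget 0 [set t | forall theta, magnus_expansion theta ->
                  forall a, C a -> component m (theta a) = t].

Definition johnson_hom (m : nat) (phi : F -> F) : 'Hom(H, Hpow R n m.+1) :=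
  lin_ext (fun a => gr_embed m.+1 (coset (lcs m.+2) (a^-1 * phi a)%g)).

End Johnson.

(* Main.v *)
(* Two Magnus expansions differ by an automorphism U of the completed tensor
   algebra with (U - 1) T_p contained in T_{p+1}: U is the quotient of the two
   substitutions sending the generators to the values of the expansions on the
   basis.  Hence the degree m component of theta on Gamma_m does not depend on
   theta.

   For phi in A(m), |phi| = 1, so U = tau^theta(phi) satisfies
   U (theta a) = theta (phi a), which is theta a modulo T_{m+1}.  Writing
   theta a = 1 + [a] + r with r in T_2, one has
     U [a] - [a] = (theta (phi a) - theta a) - (U r - r),
   and if U v - v lies in T_{j+1} for all v in H, then U r - r lies in T_{j+2}.
   Bootstrapping on j shows that U r - r lies in T_{m+2}, so the degree m + 1
   component of U [a] is that of theta (phi a) - theta a, hence that of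
   theta (a^-1 phi(a)).  The middle expression is additive in phi because
   [psi a] = [a]. *)
From HB Require Import structures.
Require Import Defs.
From mathcomp Require Import all_boot all_order all_algebra.
From mathcomp Require Import boolp classical_sets functions.

Set Implicit Arguments.
Unset Strict Implicit.

Import GRing.Theory.

Local Open Scope classical_set_scope.
Local Open Scope ring_scope.

(** * Generation of a free group by its basis *)

Section FreeGroup.
Variable F : groupType.

Lemma is_subgroup_lcs m : is_subgroup (@lcs F m).
Proof.
case: m => [|[|m]]; try by split.
split=> [A [[]]//|a b Ka Kb A [KA GA]].
by apply: KA.2; [apply: Ka|apply: Kb].
Qed.

Lemma lcs1 m : @lcs F m 1%g.
Proof. by have [] := is_subgroup_lcs m. Qed.

Section Generation.
Variable K : {pred F}.
Hypothesis Kg : group_closed K.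

Definition subgroup_of := {a : F | a \in K}.
HB.instance Definition _ := SubChoice.copy subgroup_of {a : F | a \in K}.
HB.instance Definition _ := SubChoice_isSubGroup.Build F K subgroup_of Kg.

(** The universal property gives a morphism from [F] to the subgroup; followed by the inclusion it
    fixes the basis, so by uniqueness it is the identity. *)
Lemma free_basis_pred n (x : 'I_n -> F) :
  free_basis x -> (forall i, x i \in K) -> forall a, a \in K.
Proof.
move=> hx Kx a.
have [g [[gM gx] _]] := hx subgroup_of (fun i => exist _ (x i) (Kx i)).
have [h [_ hU]] := hx F x.
suff -> : a = val (g a) by exact: valP.
have h_id : h = id by apply: hU.
have h_g : h = val \o g.
  by apply: hU; split=> [b c|i] /=; rewrite ?gM// gx.
by have /(congr1 (@^~ a)) := etrans (esym h_id) h_g.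
Qed.

End Generation.

Lemma free_basis_ind n (x : 'I_n -> F) (K : set F) :
  free_basis x -> is_subgroup K -> (forall i, K (x i)) -> forall a, K a.
Proof.
move=> hx [K1 KB] Kx a.
pose S : {pred F} := fun b => `[< K b >].
have SP b : reflect (K b) (b \in S) by exact: asboolP.
apply/SP/(@free_basis_pred _ _ _ x hx) => [|i]; last exact/SP.
by split=> [|b c /SP Kb /SP Kc]; apply/SP => //; exact: KB.
Qed.

End FreeGroup.

(** * The degree filtration and division by a leading letter *)

Section Filtration.
Variables (R : comNzRingType) (n : nat).
Local Notation T := (That R n).
Local Notation H := (Hmod R n).
Implicit Types (s t : T) (p q : nat) (U : T -> T).

Lemma ThatM s t w : (s * t) w = \sum_(k < (size w).+1) s (take k w) * t (drop k w).
Proof. by []. Qed.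

Lemma That_geW p q t : (p <= q)%N -> That_ge q t -> That_ge p t.
Proof. by move=> pq tq w wp; apply: tq; apply: leq_trans pq. Qed.

Lemma That_geD p s t : That_ge p s -> That_ge p t -> That_ge p (s + t).
Proof. by move=> sp tp w wp; rewrite -[LHS]/(s w + t w) sp// tp// addr0. Qed.

Lemma That_geN p t : That_ge p t -> That_ge p (- t).
Proof. by move=> tp w wp; rewrite -[LHS]/(- t w) tp// oppr0. Qed.

Lemma That_geB p s t : That_ge p s -> That_ge p t -> That_ge p (s - t).
Proof. by move=> sp tp; apply/That_geD/That_geN. Qed.

Lemma That_ge_sum p I (r : seq I) (f : I -> T) :
  (forall i, That_ge p (f i)) -> That_ge p (\sum_(i <- r) f i).
Proof.
by move=> fp; elim/big_ind: _ => // s t; exact: That_geD.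
Qed.

Lemma That_sumE I (r : seq I) (f : I -> T) w :
  (\sum_(i <- r) f i) w = \sum_(i <- r) f i w.
Proof. by elim/big_rec2: _ => // i y1 y2 _ <-. Qed.

Lemma That_geBC p s t : That_ge p (s - t) -> That_ge p (t - s).
Proof. by move=> /That_geN; rewrite opprB. Qed.

Lemma That_ge_trans p r s t :
  That_ge p (r - s) -> That_ge p (s - t) -> That_ge p (r - t).
Proof. by move=> rs st; rewrite -(subrKA s); exact: That_geD. Qed.

Lemma That_geM p q s t : That_ge p s -> That_ge q t -> That_ge (p + q) (s * t).
Proof.
move=> sp tq w wpq; rewrite ThatM big1// => k _.
(* A cut of a word shorter than [p + q] has a prefix shorter than [p] or a suffix shorter than
   [q]. *)
have [kp|pk] := ltnP k p.
  by rewrite sp ?mul0r// size_take_min (leq_ltn_trans (geq_minl _ _)).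
rewrite tq ?mulr0// size_drop ltn_subLR; last by rewrite -ltnS.
by rewrite (leq_trans wpq)// leq_add2r.
Qed.

Lemma That_geMl p s t : That_ge p s -> That_ge p (s * t).
Proof. by move=> sp; rewrite -[p]addn0; apply: That_geM. Qed.

Lemma That_geMr p s t : That_ge p t -> That_ge p (s * t).
Proof. by move=> sp; rewrite -[p]add0n; apply: That_geM. Qed.

Lemma That_ge_eq0 t : (forall p, That_ge p t) -> t = 0.
Proof. by move=> tp; apply/funext => w; apply: (tp (size w).+1). Qed.

Lemma That_ge_eq s t : (forall p, That_ge p (s - t)) -> s = t.
Proof. by move=> /That_ge_eq0/subr0_eq. Qed.

Lemma component_ge p s t : That_ge p.+1 (s - t) -> component p s = component p t.
Proof.
move=> st; apply/ffunP => w; rewrite !ffunE; apply/subr0_eq.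
by apply: st; rewrite size_tuple.
Qed.

Lemma component_linear p : linear (@component R n p).
Proof. by move=> c s t; apply/ffunP => w; rewrite !ffunE. Qed.

Lemma componentD p s t : component p (s + t) = component p s + component p t.
Proof. by apply/ffunP => w; rewrite !ffunE. Qed.

Lemma componentB p s t : component p (s - t) = component p s - component p t.
Proof. by apply/ffunP => w; rewrite !ffunE. Qed.

(** When [u k.+1] and [u k] agree modulo degree [k], the coordinate at [w] is constant from index
    [(size w).+1] on. *)
Definition That_lim (u : nat -> T) : T := fun w => u (size w).+1 w.

Lemma That_limP (u : nat -> T) :
  (forall k, That_ge k (u k.+1 - u k)) -> forall k, That_ge k (That_lim u - u k).
Proof.
move=> uC k w wk.
have uk j : (size w < j)%N -> u j w = u (size w).+1 w.
  elim: j => // j IHj; rewrite ltnS leq_eqVlt => /orP[/eqP->//|wj].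
  by rewrite -IHj//; apply/subr0_eq; exact: (uC j).
by rewrite -[LHS]/(u (size w).+1 w - u k w) uk// subrr.
Qed.

Lemma of_H_linear : linear (@of_H R n).
Proof.
move=> c u v; apply/funext => -[|i [|j w]]; rewrite -[RHS]/(c * _ + _) /=.
- by rewrite mulr0 addr0.
- by rewrite !mxE.
- by rewrite mulr0 addr0.
Qed.

HB.instance Definition _ := GRing.isLinear.Build R H T *:%R (@of_H R n) of_H_linear.

Lemma of_H_ge1 (v : H) : That_ge 1 (of_H v).
Proof. by move=> []. Qed.

Lemma of_H_ge2 (v : H) : That_ge 2 (of_H v) -> v = 0.
Proof. by move=> v2; apply/rowP => i; rewrite mxE; exact: (v2 [:: i]). Qed.

Lemma component_of_H p (v : H) : component p.+2 (of_H v) = 0.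
Proof.
apply/ffunP => w; rewrite !ffunE; case: w => -[|i [|j w]]//.
Qed.

Definition gen (i : 'I_n) : T := of_H (delta_mx 0 i).

Lemma genM i t w : (gen i * t) w = if w is j :: v then (j == i)%:R * t v else 0.
Proof.
case: w => [|j v]; first by rewrite ThatM big_ord1 /= mul0r.
rewrite [LHS]That_mul_cons mul0r add0r /gen /of_H /=.
rewrite /That_mul big_ord_recl big1 ?addr0 /=; last first.
  by move=> k _; case: v k => [[]//|j' v] k /=; rewrite mul0r.
by rewrite take0 drop0 !mxE /= eq_sym.
Qed.

Definition lquot (i : 'I_n) (t : T) : T := t \o cons i.

Definition const (c : R) : T := c *: 1.

(** A word is empty or has exactly one first letter. *)
Lemma That_decomp t : t = const (t [::]) + \sum_i gen i * lquot i t.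
Proof.
apply/funext => w.
rewrite -[RHS]/(const (t [::]) w + (\sum_i gen i * lquot i t) w) That_sumE.
rewrite -[X in X + _]/(t [::] * (w == [::])%:R).
case: w => [|i w]; first by rewrite mulr1 big1 ?addr0// => i _; rewrite genM.
rewrite mulr0 add0r (bigD1 i)//= big1 => [|j ji]; rewrite genM.
  by rewrite eqxx mul1r addr0.
by rewrite eq_sym (negbTE ji) mul0r.
Qed.

Lemma lquot_ge p i t : That_ge p.+1 t -> That_ge p (lquot i t).
Proof. by move=> tp w wp; apply: tp. Qed.

Lemma lquot_linear i : linear (lquot i).
Proof. by []. Qed.

(** A derivation rule twisted by the augmentation: the leading letter comes from [t] only if the
    prefix taken in [s] is empty. *)
Lemma lquotM i s t : lquot i (s * t) = s [::] *: lquot i t + lquot i s * t.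
Proof. by apply/funext => w; rewrite [LHS]That_mul_cons. Qed.

Lemma lquot1 i : lquot i 1 = 0.
Proof. by []. Qed.

Lemma lquot_gen i j : lquot i (gen j) = (i == j)%:R.
Proof.
apply/funext => w; rewrite -[LHS]/(gen j (i :: w)) -[gen j]mulr1 genM.
by case: eqP; rewrite ?mul1r ?mul0r.
Qed.

End Filtration.

(** * Substitutions and degree-raising automorphisms *)

Section Endomorphisms.
Variables (R : comNzRingType) (n : nat).
Local Notation T := (That R n).
Local Notation H := (Hmod R n).
Implicit Types (s t : T) (p : nat).

Section Substitution.
Variable f : 'I_n -> T.
Hypothesis f1 : forall i, That_ge 1 (f i).

(* [subst] is the algebra endomorphism with [gen i |-> f i], obtained by iterating
   [U t = const (t [::]) + \sum_i f i * U (lquot i t)]. *)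
Fixpoint subst_trunc k t : T :=
  if k is j.+1 then const (t [::]) + \sum_i f i * subst_trunc j (lquot i t) else 0.

Definition subst t : T := That_lim (subst_trunc^~ t).

Lemma subst_trunc_linear k : linear (subst_trunc k).
Proof.
elim: k => [|k IHk] c s t /=; first by rewrite scaler0 addr0.
rewrite -[(c *: s + t) [::]]/(c * s [::] + t [::]) /const scalerDl -scalerA scalerDr.
rewrite addrACA; congr (_ + _).
rewrite scaler_sumr -big_split; apply: eq_bigr => i _ /=.
by rewrite lquot_linear IHk mulrDr scalerAr.
Qed.

Lemma subst_linear : linear subst.
Proof.
by move=> c s t; apply/funext => w; rewrite /subst /That_lim subst_trunc_linear.
Qed.

HB.instance Definition _ := GRing.isLinear.Build R T T *:%R subst subst_linear.

(** Each unfolding multiplies the error by some [f i] of positive degree, so the truncations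
    converge. *)
Lemma subst_truncP k t : That_ge k (subst t - subst_trunc k t).
Proof.
move: k; apply: That_limP => k; elim: k t => // k IHk t.
rewrite /= opprD addrACA subrr add0r -sumrB; apply: That_ge_sum => i.
by rewrite -mulrBr -add1n; apply: That_geM => //; exact: IHk.
Qed.

Lemma subst_rec t : subst t = const (t [::]) + \sum_i f i * subst (lquot i t).
Proof.
apply: That_ge_eq => p; apply: (@That_ge_trans _ _ _ _ (subst_trunc p.+1 t)).
  exact: That_geW (leqnSn _) (@subst_truncP _ _).
apply: That_geBC; rewrite /= opprD addrACA subrr add0r -sumrB.
apply: That_ge_sum => i; rewrite -mulrBr; apply: That_geMr.
exact: subst_truncP.
Qed.

Lemma subst1 : subst 1 = 1.
Proof.
rewrite subst_rec big1 ?addr0; last by move=> i _; rewrite lquot1 linear0 mulr0.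
exact: scale1r.
Qed.

Lemma subst_gen i : subst (gen R i) = f i.
Proof.
rewrite subst_rec (scale0r 1 : const (gen R i [::]) = 0) add0r (bigD1 i)//=.
rewrite lquot_gen eqxx subst1.
rewrite mulr1 big1 ?addr0// => j ji.
by rewrite lquot_gen (negbTE ji) linear0 mulr0.
Qed.

Lemma subst_ge p t : That_ge p t -> That_ge p (subst t).
Proof.
elim: p t => // p IHp t tp; rewrite subst_rec.
rewrite [X in const X](tp [::] isT) /const scale0r add0r.
by apply: That_ge_sum => i; rewrite -add1n; apply/That_geM/IHp/lquot_ge.
Qed.

Lemma substM s t : subst (s * t) = subst s * subst t.
Proof.
have substMl u : subst (u * t) =
    u [::] *: subst t + \sum_i f i * subst (lquot i u * t).
  rewrite (subst_rec (u * t)) [X in const X]That_mul_nil (subst_rec t).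
  rewrite scalerDr -addrA; congr (_ + _); first by rewrite /const scalerA.
  rewrite scaler_sumr -big_split; apply: eq_bigr => i _.
  by rewrite lquotM linearP mulrDr -scalerAr.
(* Induction on the precision: both sides obey the same recursion in [s], and the factor [f i] gains
   one degree. *)
apply: That_ge_eq => p; elim: p s => // p IHp s.
rewrite substMl (subst_rec s) mulrDl /const -scalerAl mul1r.
rewrite opprD addrACA subrr add0r mulr_suml -sumrB; apply: That_ge_sum => i.
by rewrite -mulrA -mulrBr -add1n; apply: That_geM.
Qed.

Lemma lrmorphism_gen : exists U : {lrmorphism T -> T},
  (forall p t, That_ge p t -> That_ge p (U t)) /\ forall i, U (gen R i) = f i.
Proof.
pose U := HB.pack_for {lrmorphism T -> T} subst
  (GRing.isLinear.Build _ _ _ _ subst subst_linear)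
  (GRing.isMonoidMorphism.Build _ _ subst (conj subst1 substM)).
by exists U; split; [exact: subst_ge|exact: subst_gen].
Qed.

End Substitution.

Lemma sub_const t : That_ge 1 (t - const (t [::])).
Proof.
by case=> // _; rewrite -[LHS]/(t [::] - t [::] * 1) mulr1 subrr.
Qed.

(* The decomposition [t = const (t [::]) + \sum_i gen R i * lquot i t] is exact,
   so no continuity argument is needed. *)
Lemma lrmorphism_raise (U : {lrmorphism T -> T}) j :
  (forall p t, That_ge p t -> That_ge p (U t)) ->
  (forall i, That_ge j.+1 (U (gen R i) - gen R i)) ->
  forall p t, That_ge p t -> That_ge (p + j) (U t - t).
Proof.
move=> U_ge; elim: j => [|j IHj] Uj p t tp.
  by rewrite addn0; apply: That_geB => //; apply: U_ge.
have {}IHj := IHj (fun i => That_geW (leqnSn _) (Uj i)).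
elim: p t tp => [|p IHp] t tp.
  (* In degree 0 the constant term is fixed by [U]; the rest lies in degree 1, where the bound for
     [j] already suffices. *)
  have Uc c : U (const c) = const c by rewrite /const linearZ rmorph1.
  rewrite -(subrK (const (t [::])) t) rmorphD /= Uc opprD addrACA.
  rewrite subrr addr0 add0n -add1n.
  exact/IHj/sub_const.
rewrite [t]That_decomp [X in const X](tp [::] isT) /const scale0r add0r.
rewrite linear_sum -sumrB; apply: That_ge_sum => i /=.
(* With g the generator and q the quotient, Ug Uq - gq = (Ug - g) Uq + g (Uq - q). *)
rewrite rmorphM /= -(subrKA (gen R i * U (lquot i t))) -mulrBl -mulrBr.
have ti := lquot_ge i tp.
apply: That_geD.
  by rewrite addnC addnS -addSn; apply/That_geM/U_ge.
by rewrite addSn -add1n; apply: That_geM (IHp _ ti); exact: of_H_ge1.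
Qed.

(** Working form of the IA condition: for an algebra endomorphism it yields membership in IA, see
    [raising_IA]. *)
Definition raising (U : T -> T) : Prop :=
  forall p t, That_ge p t -> That_ge p.+1 (U t - t).

Lemma raising_ge U p t : raising U -> That_ge p t -> That_ge p (U t).
Proof.
move=> Ur tp; rewrite -(subrK t (U t)); apply: That_geD => //.
exact: That_geW (leqnSn p) (Ur _ _ tp).
Qed.

(** Climbing one degree at a time: if t lies in degree q, then U t - t lies in degree q+1, and so
    does t = U t - (U t - t). *)
Lemma raising_ge_inv U p t : raising U -> That_ge p (U t) -> That_ge p t.
Proof.
move=> Ur Utp; elim: p {-2}p (leqnn p) Utp => [|q IHq] p; first by case: p.
rewrite leq_eqVlt => /orP[/eqP->|]; last exact: IHq.
move=> Utq; rewrite -(subKr (U t) t); apply: That_geB => //.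
exact/Ur/IHq/That_geW/Utq.
Qed.

Lemma raising_comp U V : raising U -> raising V -> raising (U \o V).
Proof.
move=> Ur Vr p t tp; apply: That_ge_trans (Vr _ _ tp).
exact/Ur/raising_ge.
Qed.

(* The inverse is computed by the fixed point iteration [u := s - (U u - u)]. *)
Lemma raising_surj (U : {additive T -> T}) :
  raising U -> exists V : T -> T, cancel V U.
Proof.
move=> Ur; pose u s k := iter k (fun t => s - (U t - t)) 0.
have uS s k : u s k.+1 = s - (U (u s k) - u s k) by [].
have raiseB p r t : That_ge p (r - t) -> That_ge p.+1 ((U r - r) - (U t - t)).
  by move=> /Ur; rewrite raddfB /= opprD addrACA -opprD.
have subE s x y : s - x - (s - y) = y - x by rewrite opprB addrC subrKA.
have uC s k : That_ge k (u s k.+1 - u s k).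
  elim: k => // k IHk; rewrite (uS s k.+1) (uS s k) subE.
  exact/That_geBC/raiseB.
exists (fun s => That_lim (u s)) => s; apply: That_ge_eq => p.
set t := That_lim _; have tu := That_limP (uC s).
(* Here [s] is rewritten as [u s p.+1 + (U (u s p) - u s p)], by the definition of the iteration. *)
have -> : U t - s = (U t - t) - (U (u s p) - u s p) + (t - u s p.+1).
  have addE x y : x - y + (t - (s - y)) = x + (t - s).
    by rewrite opprB [t + _]addrC addrA subrKA -addrA [- s + t]addrC.
  by rewrite uS addE subrKA.
by apply: That_geD; [exact/That_geW/raiseB/tu|exact: That_geW (tu p.+1)].
Qed.

Lemma raising_inv (U : {lrmorphism T -> T}) : raising U ->
  exists V : {lrmorphism T -> T}, [/\ raising V, cancel U V & cancel V U].
Proof.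
move=> Ur; have [V VK] := raising_surj Ur.
have U_inj : injective U.
  move=> s t Ust; apply: That_ge_eq => p; apply: (raising_ge_inv Ur).
  by rewrite raddfB /= Ust subrr.
have UK := inj_can_sym VK U_inj.
pose V' : {lrmorphism T -> T} := HB.pack V
  (GRing.isLinear.Build _ _ _ _ V (can2_linear UK VK))
  (GRing.isMonoidMorphism.Build _ _ V (can2_monoid_morphism UK VK)).
exists V'; split=> // p t tp.
have Vtp : That_ge p (V t) by apply: (raising_ge_inv Ur); rewrite VK.
by have /That_geBC := Ur _ _ Vtp; rewrite VK.
Qed.

(** The inverse is raising too, so both preserve every ideal; the action on H is trivial by the case
    [p = 1]. *)
Lemma raising_IA (U : {lrmorphism T -> T}) : raising U -> IA_That U.
Proof.
move=> Ur; have [V [Vr UK VK]] := raising_inv Ur.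
split=> [|||p _|t t1]; [exact: linearP|exact: rmorphism_monoidP| | |exact: Ur].
  by exists V.
apply/seteqP; split=> [_ [t tp <-]|t tp]; first exact: raising_ge.
by exists (V t); [exact: raising_ge|exact: VK].
Qed.

Lemma IA_lrmorphism (U : T -> T) : IA_That U ->
  exists V : {lrmorphism T -> T}, V = U :> (T -> T).
Proof.
move=> [Ul Um _ _ _].
by exists (HB.pack_for {lrmorphism T -> T} U
  (GRing.isLinear.Build _ _ _ _ U Ul) (GRing.isMonoidMorphism.Build _ _ U Um)).
Qed.

Lemma raising_gen (f : 'I_n -> T) :
  (forall i, That_ge 2 (f i - gen R i)) ->
  exists U : {lrmorphism T -> T}, raising U /\ forall i, U (gen R i) = f i.
Proof.
move=> f2; have f1 i : That_ge 1 (f i).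
  rewrite -(subrK (gen R i) (f i)); apply: That_geD; last exact: of_H_ge1.
  exact: That_geW (f2 i).
have [U [U_ge Uf]] := lrmorphism_gen f1; exists U; split=> // p t tp.
(* The case [j = 1] of [lrmorphism_raise]. *)
by rewrite -addn1; apply: lrmorphism_raise => // i; rewrite Uf.
Qed.

Lemma raising_transitive (f g : 'I_n -> T) :
  (forall i, That_ge 2 (f i - gen R i)) -> (forall i, That_ge 2 (g i - gen R i)) ->
  exists U : {lrmorphism T -> T}, raising U /\ forall i, U (f i) = g i.
Proof.
move=> /raising_gen[V [Vr Vf]] /raising_gen[W [Wr Wg]].
have [V' [V'r VK _]] := raising_inv Vr.
exists (W \o V'); split; first exact: raising_comp.
by move=> i; rewrite /= -Vf VK Wg.
Qed.

End Endomorphisms.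

(** This removes |phi| from the equation defining [johnson_total] when phi acts trivially on H. *)
Lemma That_map1 (R : comNzRingType) n (t : That R n) : That_map \1%VF t = t.
Proof.
apply/funext => w; rewrite /That_map /Hpow_map sum_ffunE (bigD1 (in_tuple w))//=.
rewrite !ffunE big1 => [|k _]; last by rewrite id_lfunE mxE !eqxx.
rewrite [_ *: _]mulr1 big1 ?addr0// => v vw; rewrite !ffunE.
have [k vk] : exists k, tnth (in_tuple w) k != tnth v k.
  apply: contrapT => /forallNP vw'; move/eqP: vw; apply.
  by apply: eq_from_tnth => k; apply/esym/eqP; have /negP/negPn := vw' k.
by rewrite (bigD1 k)//= id_lfunE mxE eqxx (negbTE vk) mul0r scaler0.
Qed.

(** * Magnus expansions on the lower central series *)

Section MagnusExpansions.
Variables (R : comNzRingType) (n : nat) (F : groupType) (x : 'I_n -> F).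
Hypothesis hx : free_basis x.
Local Notation T := (That R n).
Local Notation H := (Hmod R n).
Local Notation cls := (hclass R x).
Implicit Types (theta : F -> T) (phi psi : F -> F).

Lemma hclassM a b : cls (a * b)%g = cls a + cls b.
Proof. exact: (hclassP R hx).1. Qed.

Lemma lin_ext_unique (M : vectType R) (g : 'Hom(H, M)) (f : F -> M) :
  (forall a, g (cls a) = f a) -> g = lin_ext x f.
Proof.
move=> gf; have fM : {morph f : a b / (a * b)%g >-> a + b}.
  by move=> a b; rewrite -!gf hclassM linearD.
by have [_ fU] := lin_extP hx fM; exact: fU.
Qed.

Section Expansion.
Variable theta : F -> T.
Hypothesis htheta : magnus_expansion x theta.

Lemma magnus_ge1 a : That_ge 1 (theta a - 1).
Proof. by have [] := htheta. Qed.

Lemma magnusM a b : theta (a * b)%g = theta a * theta b.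
Proof. by have [_ ->] := htheta. Qed.

Lemma magnus_ge2 a : That_ge 2 (theta a - (1 + of_H (cls a))).
Proof. by have [] := htheta. Qed.

(* [1 - theta 1] is an idempotent of the ideal [That_ge 1]. *)
Lemma magnus1 : theta 1%g = 1.
Proof.
apply/esym/That_ge_eq; elim=> // p IHp.
have e2 : theta 1%g * theta 1%g = theta 1%g by rewrite -magnusM mulg1.
have -> : 1 - theta 1%g = (1 - theta 1%g) * (1 - theta 1%g).
  by rewrite mulrBr mulr1 mulrBl mul1r e2 subrr subr0.
by rewrite -add1n; apply: That_geM => //; apply/That_geBC/magnus_ge1.
Qed.

Lemma magnusV a : theta a^-1%g * theta a = 1.
Proof. by rewrite -magnusM mulVg magnus1. Qed.

Lemma magnus_divB a b : theta (a * b^-1)%g - 1 = (theta a - theta b) * theta b^-1%g.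
Proof. by rewrite mulrBl -!magnusM mulgV magnus1. Qed.

Lemma magnus_lcs m a : lcs m.+1 a -> That_ge m.+1 (theta a - 1).
Proof.
elim: m a => [|m IHm] a; first by move=> _; exact: magnus_ge1.
(* It suffices that this set is a subgroup containing the generating commutators. *)
move=> /(_ [set b | That_ge m.+2 (theta b - 1)]); apply; split=> [|_ [b bm [c ->]]].
  split=> [|b c bm cm]; first by rewrite /= magnus1 subrr.
  rewrite /= magnus_divB; apply: That_geMl.
  by apply: (That_ge_trans (s := 1)) => //; exact: That_geBC.
(* Writing 1 as theta((cb)^-1) theta(cb) leaves, up to left factors, the ring commutator of theta b
   and theta c, equal to that of theta b - 1 and theta c - 1. *)
rewrite /= /commg /conjg -[X in _ - X](magnusV (c * b)) invgM !magnusM -!mulrA.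
rewrite -!mulrBr; apply/That_geMr/That_geMr.
have -> : theta b * theta c - theta c * theta b =
    (theta b - 1) * (theta c - 1) - (theta c - 1) * (theta b - 1).
  have mulB1 (u v : T) : (u - 1) * (v - 1) = u * v - (u + v - 1).
    by rewrite mulrBl mulrBr mul1r mulr1 -addrA -opprD addrA.
  rewrite !mulB1 [theta c + _]addrC; move: (theta b + _ - 1) => s.
  by rewrite opprB subrKA.
apply: That_geB; [rewrite -addn1|rewrite -add1n];
  by apply: That_geM; first [exact: magnus_ge1|exact: IHm].
Qed.

End Expansion.

Lemma magnus_transitive theta theta' :
  magnus_expansion x theta -> magnus_expansion x theta' ->
  exists U : {lrmorphism T -> T}, raising U /\ forall a, U (theta a) = theta' a.
Proof.
move=> th th'.
have gen2 (eta : F -> T) : magnus_expansion x eta ->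
    forall i, That_ge 2 (eta (x i) - 1 - gen R i).
  by move=> he i; rewrite -addrA -opprD /gen -(hclassP R hx).2; exact: magnus_ge2.
have [U [Ur Ux]] := raising_transitive (gen2 _ th) (gen2 _ th').
(* [U] matches the expansions on the basis, and the elements where they match form a subgroup. *)
exists U; split=> //; apply: (free_basis_ind hx).
  have UV a : U (theta a) = theta' a -> U (theta a^-1%g) = theta' a^-1%g.
    move=> Ua; rewrite -[LHS]mulr1 -[in LHS](magnus1 th') -(mulgV a) (magnusM th').
    by rewrite mulrA -Ua -rmorphM (magnusV th) rmorph1 mul1r.
  split=> [|a b Ka Kb]; first by rewrite (magnus1 th) (magnus1 th') rmorph1.
  by rewrite (magnusM th) (magnusM th') rmorphM /= Ka UV.
by move=> i; rewrite -(subrK 1 (theta (x i))) rmorphD rmorph1 /= Ux subrK.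
Qed.

Lemma magnus_lcs_component theta theta' m a :
  magnus_expansion x theta -> magnus_expansion x theta' -> lcs m.+1 a ->
  component m.+1 (theta' a) = component m.+1 (theta a).
Proof.
move=> th th' am; have [U [Ur Ua]] := magnus_transitive th th'.
apply: component_ge; rewrite -Ua -(subrK 1 (theta a)) rmorphD rmorph1 /=.
by rewrite opprD addrACA subrr addr0; apply/Ur/magnus_lcs.
Qed.

Lemma component1 m : component m.+1 (1 : T) = 0.
Proof. by apply/ffunP => w; rewrite !ffunE; case: w => -[|i w]. Qed.

(** The discrepancy is (theta a - 1)(theta c - 1), of degree at least m+2. *)
Lemma magnus_component_mul theta m a c : magnus_expansion x theta -> lcs m.+1 c ->
  component m.+1 (theta (a * c)%g - theta a) = component m.+1 (theta c).
Proof.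
move=> th cm; rewrite -[RHS]subr0 -(component1 m) -componentB.
apply: component_ge; have -> : theta (a * c)%g - theta a - (theta c - 1) =
    (theta a - 1) * (theta c - 1).
  by rewrite (magnusM th) mulrBl mul1r mulrBr mulr1.
rewrite -add1n.
by apply: That_geM; [exact: magnus_ge1|exact: magnus_lcs].
Qed.

Lemma gr_embedE theta m c : magnus_expansion x theta -> lcs m.+1 c ->
  gr_embed R x m.+1 (coset (lcs m.+2) c) = component m.+1 (theta c).
Proof.
move=> th cm; rewrite /gr_embed.
case: xgetP => [t _ /(_ _ th c)|/(_ (component m.+1 (theta c)))[]].
  by move=> -> //; exists 1%g; [exact: lcs1|rewrite mulg1].
(* The set defining [gr_embed] is inhabited: the component depends neither on the expansion nor on
   the representative of the coset. *)
move=> theta' th' _ [d dm <-]; rewrite -(magnus_lcs_component th th' cm).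
apply: component_ge; rewrite (magnusM th') -[X in _ - X]mulr1 -mulrBr.
by apply/That_geMr/(magnus_lcs th').
Qed.

(** * The Johnson map near the identity *)

Section JohnsonMap.
Variables (theta : F -> T) (m : nat).
Hypothesis htheta : magnus_expansion x theta.

(* The condition [andreadakis m.+1 phi], as seen through theta. *)
Definition close_to_id phi : Prop :=
  {morph phi : a b / (a * b)%g} /\
  forall a, That_ge m.+2 (theta (phi a) - theta a).

Lemma close_to_id_comp phi psi : close_to_id phi -> close_to_id psi ->
  close_to_id (phi \o psi).
Proof.
move=> [phiM hphi] [psiM hpsi]; split=> [a b|a]; first by rewrite /= psiM phiM.
exact: That_ge_trans (hphi _) (hpsi _).
Qed.

Lemma close_to_id_magnus phi : close_to_id phi -> magnus_expansion x (theta \o phi).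
Proof.
move=> [phiM hphi]; split=> [a|a b|a] /=; first exact: (magnus_ge1 htheta).
  by rewrite phiM (magnusM htheta).
exact: That_ge_trans (That_geW _ (hphi a)) (magnus_ge2 htheta a).
Qed.

(** Both 1 + [phi a] and 1 + [a] agree with theta(phi a) modulo degree 2. *)
Lemma close_to_id_hclass phi a : close_to_id phi -> cls (phi a) = cls a.
Proof.
move=> hphi; apply/subr0_eq/of_H_ge2; rewrite linearB.
have -> : of_H (cls (phi a)) - of_H (cls a) =
    1 + of_H (cls (phi a)) - (1 + of_H (cls a)) by rewrite opprD addrACA subrr add0r.
apply: That_ge_trans (magnus_ge2 (close_to_id_magnus hphi) a).
exact/That_geBC/(magnus_ge2 htheta).
Qed.

Lemma close_to_id_aut_H phi : close_to_id phi -> aut_H R x phi = \1%VF.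
Proof.
move=> hphi; apply/esym/lin_ext_unique => a.
by rewrite id_lfunE /= close_to_id_hclass.
Qed.

Lemma johnson_totalP phi : close_to_id phi ->
  IA_That (johnson_total x theta phi) /\
  forall a, johnson_total x theta phi (theta a) = theta (phi a).
Proof.
move=> hphi; rewrite /johnson_total (close_to_id_aut_H hphi).
(* As theta o phi is again a Magnus expansion, transitivity supplies a witness for the choice in
   [johnson_total]. *)
have [U [Ur Ua]] := magnus_transitive htheta (close_to_id_magnus hphi).
pose S := [set U : T -> T | IA_That U /\ theta \o phi = U \o That_map \1%VF \o theta].
have [IA_U thU] : S (xget (idfun : T -> T) S).
  apply: (@xgetI _ (idfun : T -> T) S (U : T -> T)); split; first exact: raising_IA.
  by apply/funext => a; rewrite /= That_map1 Ua.
by split=> // a; have /(congr1 (@^~ a)) := thU; rewrite /= That_map1.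
Qed.

Lemma johnson_total_component phi a : close_to_id phi ->
  component m.+2 (johnson_total x theta phi (of_H (cls a))) =
  component m.+2 (theta (phi a) - theta a).
Proof.
move=> hphi; have [IA_U Utheta] := johnson_totalP hphi.
have [U UE] := IA_lrmorphism IA_U; have [_ _ _ IA_ge _] := IA_U.
rewrite -UE in IA_ge Utheta *.
have U_ge p t : That_ge p t -> That_ge p (U t).
  by case: p => // p tp; rewrite -(IA_ge p.+1)//; exists t.
pose r b := theta b - (1 + of_H (cls b)).
have UB b : U (of_H (cls b)) - of_H (cls b) =
    (theta (phi b) - theta b) - (U (r b) - r b).
  have rE : theta b - r b = 1 + of_H (cls b) by rewrite subKr.
  transitivity (U (theta b - r b) - (theta b - r b)).
    by rewrite rE rmorphD rmorph1 /= opprD addrACA subrr add0r.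
  by rewrite raddfB /= Utheta opprD addrACA -opprD.
(* The bootstrap: a bound j+1 on generators gives j+2 on U r - r, hence on generators by [UB], until
   theta(phi b) - theta b limits it at m+2. *)
have Ugen j : (j <= m.+1)%N -> forall i, That_ge j.+1 (U (gen R i) - gen R i).
  elim: j => [_ i|j IHj jm i].
    by apply: That_geB; [apply: U_ge|]; exact: of_H_ge1.
  rewrite /gen -(hclassP R hx).2 UB; apply: That_geB.
    exact: That_geW (hphi.2 _).
  rewrite -add2n; apply: lrmorphism_raise (magnus_ge2 htheta _) => //.
  exact/IHj/ltnW.
(* Subtracting [a], which has no part in degree m+2, brings [UB] into play. *)
rewrite -[LHS]subr0 -(component_of_H m (cls a)) -componentB UB.
apply: component_ge; rewrite addrAC subrr add0r; apply: That_geN.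
rewrite -(add2n m.+1); apply: lrmorphism_raise (magnus_ge2 htheta _) => //.
exact: Ugen.
Qed.

Lemma johnson_mapE phi a : close_to_id phi ->
  johnson_map x theta m.+1 phi (cls a) = component m.+2 (theta (phi a) - theta a).
Proof.
move=> hphi; rewrite -johnson_total_component//.
have [[Ul _ _ _ _] _] := johnson_totalP hphi.
(* [linfun] returns the intended values once this map is known to be linear. *)
pose g v := component m.+2 (johnson_total x theta phi (of_H v)).
have gl : linear g by move=> c u v; rewrite /g linearP Ul component_linear.
pose G := HB.pack_for {linear H -> Hpow R n m.+2} g
  (GRing.isLinear.Build _ _ _ _ g gl).
exact: (lfunE G).
Qed.

End JohnsonMap.

(** * Comparison with the Johnson homomorphism *)

Lemma andreadakis_lcs m phi a : andreadakis m phi -> lcs m.+1 (a^-1 * phi a)%g.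
Proof.
move=> [_ /(_ a) phia].
have : coset (lcs m.+1) (phi a) (phi a).
  by exists 1%g; [exact: lcs1|rewrite mulg1].
by rewrite phia => -[d dm <-]; rewrite mulKg.
Qed.

Lemma andreadakis_close_to_id theta m phi : magnus_expansion x theta ->
  andreadakis m.+1 phi -> close_to_id theta m phi.
Proof.
move=> th phim; split=> [|a]; first by have [[]] := phim.
rewrite -(mulVKg a (phi a)) (magnusM th) -[X in _ - X]mulr1 -mulrBr.
exact/That_geMr/(magnus_lcs th)/andreadakis_lcs.
Qed.

Lemma johnson_homE theta m phi : magnus_expansion x theta ->
  andreadakis m.+1 phi -> johnson_hom R x m.+1 phi = johnson_map x theta m.+1 phi.
Proof.
move=> th phim; apply/esym/lin_ext_unique => a.
rewrite (gr_embedE th (andreadakis_lcs a phim)).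
rewrite (johnson_mapE th _ (andreadakis_close_to_id th phim)).
(* With phi a = a c and c = a^-1 phi(a), the component of theta(ac) - theta a is that of theta c. *)
rewrite -[in LHS](mulVKg a (phi a)).
exact: magnus_component_mul (andreadakis_lcs a phim).
Qed.

End MagnusExpansions.

Theorem theorem3p1 (n : nat) (hn : (2 <= n)%N) (R : comNzRingType)
    (hR : injective (fun z : int => z%:~R : R))
    (F : groupType) (x : 'I_n -> F) (hx : free_basis x)
    (theta : F -> That R n) (htheta : magnus_expansion x theta)
    (m : nat) (hm : (1 <= m)%N) :
  [/\ forall phi : F -> F, andreadakis m phi ->
        johnson_hom R x m phi = johnson_map x theta m phi,
      forall phi psi : F -> F, andreadakis m phi -> andreadakis m psi ->
        johnson_map x theta m (phi \o psi) =
        johnson_map x theta m phi + johnson_map x theta m psi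
    & forall theta' : F -> That R n, magnus_expansion x theta' ->
        forall phi : F -> F, andreadakis m phi ->
        johnson_map x theta' m phi = johnson_map x theta m phi].
Proof.
case: m hm => // m _; split=> [phi phim|phi psi phim psim|theta' th' phi phim].
- exact: johnson_homE.
- have hphi := andreadakis_close_to_id htheta phim.
  have hpsi := andreadakis_close_to_id htheta psim.
  (* The right side is the linear extension of its own values on classes, so comparison there
     suffices. *)
  rewrite [RHS](lin_ext_unique hx (frefl _)); apply: (lin_ext_unique hx) => a.
  (* Evaluating at psi a, which has the class of a, makes the two differences telescope. *)
  have phi_psi_a : johnson_map x theta m.+1 phi (hclass R x a) =
      component m.+2 (theta (phi (psi a)) - theta (psi a)).
    by rewrite -(close_to_id_hclass htheta a hpsi) (johnson_mapE hx htheta).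
  rewrite add_lfunE phi_psi_a (johnson_mapE hx htheta _ hpsi).
  rewrite (johnson_mapE hx htheta _ (close_to_id_comp hphi hpsi)).
  by rewrite -componentD subrKA.
- by rewrite -(johnson_homE hx th' phim) (johnson_homE hx htheta phim).
Qed.
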